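(* Let $\mathcal O$ be the adjoint orbit of a non-zero nilpotent matrix in a complex classical Lie algebra ($\mathfrak{sl}(n,\mathbb C)$, $\mathfrak{so}(n,\mathbb C)$ or $\mathfrak{sp}(n,\mathbb C)$), and assume that $X^2=0$ for $X\in\mathcal O$. For $X\in\mathcal O$ let $\operatorname{Spec}(X^*X)=\{\mu_1,\dots,\mu_r\}$ be the set of distinct eigenvalues of $X^*X$ and let $k_i$ be the multiplicity of $\mu_i$. Then the hyperKähler potential $\rho$ for the canonical hyperKähler metric on $\mathcal O$ is given by $$\rho(X)=2\sum_{\mu_i\in\operatorname{Spec}(X^*X)}k_i\,\mu_i^{1/2}.$$
   Context: Matrix conventions. $\mathfrak{sl}(n,\mathbb C)$ acts on $\mathbb C^N$ with $N=n$; $\mathfrak{so}(n,\mathbb C)$ acts on $\mathbb C^N$, $N=n$, preserving a non-degenerate symmetric bilinear form; $\mathfrak{sp}(n,\mathbb C)$ acts on $\mathbb C^N$, $N=2n$, preserving a non-degenerate skew bilinear form. $\mathbb C^N$ carries a Hermitian inner product, compatible with the bilinear form when there is one: in some orthonormal basis the bilinear form has as matrix the identity (symmetric case) or $\begin{pmatrix}0&\mathbf 1\\-\mathbf 1&0\end{pmatrix}$ (skew case). $X^*$ denotes the Hermitian adjoint. HyperKähler potential. A hyperKähler manifold is a Riemannian manifold with complex structures $I,J,K$ satisfying $IJ=K=-JI$, for each of which $g$ is Hermitian, and such that $\omega_I(X,Y)=g(X,IY)$, $\omega_J$, $\omega_K$ are closed. A real function $\rho$ is a hyperKähler potential if it is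 simultaneously a Kähler potential for $(\omega_I,I)$, $(\omega_J,J)$, $(\omega_K,K)$, normalised so that on a flat quaternionic vector space with norm $r$ the potential is $r^2$; that is, $\omega_A=\tfrac14\,d(d\rho\circ A)$ for $A=I,J,K$, with the usual exterior derivative. Canonical hyperKähler structure and its potential. Let $\mathcal O$ be the orbit of a nilpotent $A$ with $A^{k}=0$, $A^{k-1}\neq0$. Let $V_i$ ($0\le i\le k$) be Hermitian vector spaces with $\dim V_i=\operatorname{rank}A^{k-i}$, $V_0=0$, $V_k=\mathbb C^N$, and let $W=\bigoplus_{i=0}^{k-1}\bigl(\operatorname{Hom}(V_i,V_{i+1})\oplus\operatorname{Hom}(V_{i+1},V_i)\bigr)$, with elements $(\alpha_i,\beta_i)_i$, $\alpha_i:V_i\to V_{i+1}$, $\beta_i:V_{i+1}\to V_i$, norm $r^2=\sum_{i=1}^{k-1}\operatorname{Tr}(\alpha_i^*\alpha_i+\beta_i\beta_i^* )$, $I$ being multiplication by $\sqrt{-1}$ and $J$ being $(\alpha_i,\beta_i)\mapsto(-\beta_i^*,\alpha_i^* )$. For $\mathfrak{sl}(n,\mathbb C)$ use $W$ with the natural action of $H=U(V_1)\times\dots\times U(V_{k-1})$. For $\mathfrak{so}(n,\mathbb C)$ (put $\delta=0$) or $\mathfrak{sp}(n,\mathbb C)$ (put $\delta=1$), equip each $V_i$ with a non-degenerate bilinear form $\omega_i$ with $\omega_i(X,Y)=(-1)^{k-i+\delta}\omega_i(Y,X)$, compatible with the Hermitian product on $V_i$ in the sense that in some orthonormal basis of $V_i$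 the form $\omega_i$ has as matrix the identity (if $\omega_i$ is symmetric) or $\begin{pmatrix}0&\mathbf 1\\-\mathbf 1&0\end{pmatrix}$ (if $\omega_i$ is skew), and equal to the given form on $V_k$; let $\dagger$ denote adjoint with respect to the $\omega_i$; replace $W$ by its quaternionic subspace $W^+=\{\beta_i=\alpha_i^\dagger,\ i=1,\dots,k-1\}$ and $H$ by $\prod_{i=1}^{k-1}H_i$, $H_i=\{A\in U(V_i):A^\dagger A=\mathrm{Id}\}$. The zero set $\mu^{-1}(0)$ of the hyperKähler moment map is given by the equations, for $i=0,\dots,k-2$, $$\alpha_i\beta_i=\beta_{i+1}\alpha_{i+1},\qquad \alpha_i\alpha_i^*-\beta_i^*\beta_i+\beta_{i+1}\beta_{i+1}^*-\alpha_{i+1}^*\alpha_{i+1}=0 .$$ On the open subset of $\mu^{-1}(0)$ where all $\alpha_i$ are injective and all $\beta_i$ surjective, the map $\psi(\dots,\alpha_i,\beta_i,\dots)=\alpha_{k-1}\beta_{k-1}$ induces a diffeomorphism from the quotient by $H$ onto the orbit of $A$ under $GL(n,\mathbb C)$, $O(n,\mathbb C)$ or $Sp(n,\mathbb C)$ respectively. The hyperKähler quotient structure transported to the orbit is the canonical hyperKähler structure, and its hyperKähler potential is the function induced by $r^2$: $\rho(X)=r^2(\alpha,\beta)$ for any point $(\alpha,\beta)$ of this subset with $\alpha_{k-1}\beta_{k-1}=X$. (When the adjoint orbit is only a connected component of this larger orbit, restrict.) *)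

(* Defs.v *)
From mathcomp Require Export all_boot all_order all_algebra.
From mathcomp Require Export sesquilinear spectral.
From mathcomp Require Export boolp classical_sets fsbigop reals.
From mathcomp Require Export complex.

Set Implicit Arguments.
Unset Strict Implicit.
Unset Printing Implicit Defensive.

Import Order.TTheory GRing.Theory Num.Theory.
Local Open Scope classical_set_scope.
Local Open Scope ring_scope.
Local Open Scope sesquilinear_scope.
Local Open Scope complex_scope.

(* Hermitian spaces are C^n with its standard Hermitian product, vectors are
   columns, a linear map C^n -> C^m is a matrix in 'M_(m, n), its Hermitian
   adjoint is M ^t*, and a bilinear form is given by the matrix Om with
   omega(x, y) = x^T *m Om *m y. *)

Section Forms.
Variable R : realType.
Local Notation C := R[i].

(* The rows of U are the (transposed) vectors of an orthonormal basis in which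
   the form is the identity, resp. the standard symplectic matrix. *)
Definition compatible_form (skew : bool) (n : nat) (Om : 'M[C]_n) : Prop :=
  if skew then
    exists (m : nat) (U : 'M[C]_(m + m, n)),
      [/\ n = (m + m)%N, U \is unitarymx
        & U *m Om *m U^T = block_mx 0 1%:M (- 1%:M) 0]
  else
    exists U : 'M[C]_n, U \is unitarymx /\ U *m Om *m U^T = 1%:M.

(* The adjoint of alpha : (C^n, Oms) -> (C^m, Omt), characterised by
   Omt(alpha x, y) = Oms(x, form_adjoint y). *)
Definition form_adjoint (m n : nat) (Omt : 'M[C]_m) (Oms : 'M[C]_n)
    (alpha : 'M[C]_(m, n)) : 'M[C]_(n, m) :=
  invmx Oms *m alpha^T *m Omt.

Variant classical_lie (N : nat) :=
  | LieSl
  | LieSo of 'M[C]_N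
  | LieSp of 'M[C]_N.

(* For LieSp this forces N to be even; the rank of sp is then N./2. *)
Definition classical_lie_ok (N : nat) (g : classical_lie N) : Prop :=
  match g with
  | LieSl => True
  | LieSo Om => compatible_form false Om
  | LieSp Om => compatible_form true Om
  end.

Definition in_lie (N : nat) (g : classical_lie N) (X : 'M[C]_N) : Prop :=
  match g with
  | LieSl => \tr X = 0
  | LieSo Om | LieSp Om => X^T *m Om + Om *m X = 0
  end.

(* The connected groups SL, SO and Sp, so that the orbits below are those of the
   adjoint group. *)
Definition in_group (N : nat) (g : classical_lie N) (P : 'M[C]_N) : Prop :=
  match g with
  | LieSl => \det P = 1
  | LieSo Om => P^T *m Om *m P = Om /\ \det P = 1
  | LieSp Om => P^T *m Om *m P = Om
  end.

Definition adjoint_orbit (N : nat) (g : classical_lie N) (A : 'M[C]_N) :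
    set 'M[C]_N :=
  [set X | exists P : 'M[C]_N, in_group g P /\ X = P *m A *m invmx P].

End Forms.

Arguments LieSl {R N}.

(* The chain V_0, ..., V_k is indexed from the top: the space V_(k - j) is
   C^(chain_dim A j), so that V_k is C^N definitionally and no type cast is
   needed. Under this reindexing i = k - 1 - j:
     qalpha j is alpha_i : V_i -> V_(i+1),  qbeta j is beta_i : V_(i+1) -> V_i.
   All the spaces with j >= k are zero when A ^+ k = 0. *)
Section Quiver.
Variable R : realType.
Local Notation C := R[i].
Variables (N : nat) (A : 'M[C]_N).

Definition chain_dim (j : nat) : nat :=
  if j is j'.+1 then \rank (A ^+ j'.+1) else N.

Record quiver_point := QuiverPoint {
  qalpha : forall j, 'M[C]_(chain_dim j, chain_dim j.+1);
  qbeta : forall j, 'M[C]_(chain_dim j.+1, chain_dim j)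
}.

Variables (g : classical_lie R N) (k : nat).

(* The form on V_(k - j) has sign (-1)^(j + delta), with delta = 0 for so and
   delta = 1 for sp, and on V_k it is the given one. For sl there are no forms,
   and om is not used. *)
Definition chain_forms_ok (om : forall j, 'M[C]_(chain_dim j)) : Prop :=
  match g with
  | LieSl => True
  | LieSo Om => om 0%N = Om /\
      forall j, (j <= k)%N -> compatible_form (odd j) (om j)
  | LieSp Om => om 0%N = Om /\
      forall j, (j <= k)%N -> compatible_form (odd j.+1) (om j)
  end.

Variable om : forall j, 'M[C]_(chain_dim j).

Definition in_Wspace (p : quiver_point) : Prop :=
  match g with
  | LieSl => True
  | LieSo _ | LieSp _ => forall j, (j < k.-1)%N ->
      qbeta p j = form_adjoint (om j) (om j.+1) (qalpha p j)
  end.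

Definition moment_zero (p : quiver_point) : Prop :=
  forall j, (j < k.-1)%N ->
    qalpha p j.+1 *m qbeta p j.+1 = qbeta p j *m qalpha p j /\
    qalpha p j.+1 *m (qalpha p j.+1)^t* - (qbeta p j.+1)^t* *m qbeta p j.+1
      + qbeta p j *m (qbeta p j)^t* - (qalpha p j)^t* *m qalpha p j = 0.

Definition quiver_regular (p : quiver_point) : Prop :=
  forall j, (j < k)%N ->
    injective (fun x : 'cV[C]_(chain_dim j.+1) => qalpha p j *m x) /\
    (forall y : 'cV[C]_(chain_dim j.+1),
       exists x : 'cV[C]_(chain_dim j), qbeta p j *m x = y).

Definition quiver_psi (p : quiver_point) : 'M[C]_N :=
  qalpha p 0 *m qbeta p 0.

Definition quiver_norm2 (p : quiver_point) : C :=
  \sum_(j < k.-1) \tr ((qalpha p j)^t* *m qalpha p j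
                       + qbeta p j *m (qbeta p j)^t*).

(* rho is the function induced on the adjoint orbit of A by the squared norm,
   through the identification of the orbit with (an open and closed part of)
   the hyperKaehler quotient of the regular points. *)
Definition hyperKahler_potential (rho : 'M[C]_N -> R) : Prop :=
  forall X : 'M[C]_N, adjoint_orbit g A X ->
  forall p : quiver_point,
    in_Wspace p -> moment_zero p -> quiver_regular p -> quiver_psi p = X ->
    (rho X)%:C = quiver_norm2 p.

End Quiver.

Section Spectrum.
Variable R : realType.
Local Notation C := R[i].

Definition spectrum (n : nat) (M : 'M[C]_n) : set C :=
  [set mu | eigenvalue M mu].

Definition multiplicity (n : nat) (M : 'M[C]_n) (mu : C) : nat :=
  mup mu (char_poly M).

End Spectrum.

(* Main.v *)
Require Import Defs.

Set Implicit Arguments.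
Unset Strict Implicit.
Unset Printing Implicit Defensive.

Import Order.TTheory GRing.Theory Num.Theory.
Local Open Scope classical_set_scope.
Local Open Scope ring_scope.
Local Open Scope sesquilinear_scope.
Local Open Scope complex_scope.

(** Since the orbit squares to zero and is not zero, k = 2, and a point of the
    quiver over X is a pair of maps a : V_1 -> C^N, b : C^N -> V_1 with X = a b.
    The moment map equations reduce to b a = 0 and b b^* = a^* a. Hence

      X^* X = b^* (a^* a) b = b^* (b b^* ) b = (b^* b)^2,

    so b^* b is the positive square root of X^* X and its trace is the sum of
    the k_i mu_i^(1/2) ([sum_sqrt_spectrum]). The squared norm of the point is
    tr (a^* a + b b^* ) = 2 tr (b b^* ) = 2 tr (b^* b), which is the formula
    ([quiver_norm2_two_step]).

    This shows that the formula implies that rho is the potential. Conversely,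
    the definition of the potential constrains rho X only through the points
    over X, so one has to know that every X in the orbit has such a point. By
    the spectral theorem there is b with linearly independent rows such that
    (b^* b)^2 = X^* X ([gram_root]), and then a = X b^* (b b^* )^-1 completes it
    to a pair ([balanced_factorization_exists]). This settles sl.

    For so and sp the pair must also satisfy b = a^dagger. By uniqueness of
    positive square roots, two pairs over the same X differ by a unitary u of
    V_1 ([balanced_factorization_unique]). With Om the form on C^N, of sign
    eps, the pair (- Om^-1 b^T, a^T Om) again lies over X, so that a^T Om = u b
    and a = - Om^-1 b^T u for some unitary u. Comparing the first equation
    transposed with the second gives u^T = - eps u, which is exactly the
    symmetry of the form prescribed on V_1. As unitary matrices of a given
    symmetry are all congruent under the unitary group ([compatible_form_congr]),
    a unitary change of basis of V_1 turns u into that form, and a^T Om = u b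
    then says b = a^dagger ([adjoint_factorization_exists]). *)

(** * Adjoints and unitary diagonalisation *)

Section HermitianMatrices.
Variable C : numClosedFieldType.

Lemma adjmxM m n p (A : 'M[C]_(m, n)) (B : 'M[C]_(n, p)) :
  (A *m B)^t* = B^t* *m A^t*.
Proof. by rewrite trmx_mul map_mxM. Qed.

Lemma adjmxN m n (A : 'M[C]_(m, n)) : (- A)^t* = - A^t*.
Proof. by apply/matrixP=> i j; rewrite !mxE rmorphN. Qed.

Lemma adjmx1 n : (1%:M : 'M[C]_n)^t* = 1%:M.
Proof. by rewrite trmx1 map_mx1. Qed.

Lemma adjmxV n (A : 'M[C]_n) : (invmx A)^t* = invmx (A^t*).
Proof. by rewrite trmx_inv map_invmx. Qed.

Lemma gram_entry_ge0 m n (B : 'M[C]_(m, n)) i : 0 <= (B *m B^t*) i i.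
Proof.
by rewrite mxE sumr_ge0 // => j _; rewrite !mxE mul_conjC_ge0.
Qed.

(** The left kernel of X is orthogonal to the row space of X^*, so multiplying
    X^* by X loses no rank. *)
Lemma rank_adj_mul m n (X : 'M[C]_(m, n)) : \rank (X^t* *m X) = \rank X.
Proof.
have XX0 : (X^t* :&: kermx X)%MS = 0.
  apply/orthomx_disj; rewrite orthomx_sym; apply/orthomx1P.
  by rewrite trmxCK mulmx_ker.
have := mxrank_mul_ker (X^t*) X.
by rewrite XX0 mxrank0 addn0 mxrank_map mxrank_tr.
Qed.

Lemma normalmx_diag n (A : 'M[C]_n) : A *m A^t* = A^t* *m A ->
  exists (V : 'M[C]_n) (d : 'rV_n), V \is unitarymx /\ A = V^t* *m diag_mx d *m V.
Proof.
move=> /normalmxP/orthomx_spectralP A_eq.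
exists (spectralmx A), (spectral_diag A); split; first exact: spectral_unitarymx.
by rewrite -invmx_unitary ?spectral_unitarymx.
Qed.

Lemma unitary_mulV n (V : 'M[C]_n) : V \is unitarymx -> V^t* *m V = 1%:M.
Proof. by move=> Vu; rewrite -invmx_unitary // mulVmx // unitarymx_unit. Qed.

Lemma gram_diag m n (B : 'M[C]_(m, n)) :
  exists (V : 'M[C]_n) (d : 'rV_n), [/\ V \is unitarymx,
    B^t* *m B = V^t* *m diag_mx d *m V & forall i, 0 <= d 0 i].
Proof.
have [V [d [Vu Bd]]] : exists (V : 'M[C]_n) (d : 'rV_n), V \is unitarymx /\
    B^t* *m B = V^t* *m diag_mx d *m V.
  by apply: normalmx_diag; rewrite adjmxM trmxCK.
exists V, d; split=> // i.
have -> : d 0 i = ((V *m B^t*) *m (V *m B^t*)^t*) i i.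
  have VV := unitarymxP Vu.
  rewrite adjmxM trmxCK mulmxA -(mulmxA V) Bd !mulmxA VV mul1mx -mulmxA VV mulmx1.
  by rewrite mxE eqxx mulr1n.
exact: gram_entry_ge0.
Qed.

(** The commutation relation says d_i T_ij = T_ij e_j, so T_ij vanishes unless
    d_i = e_j, in which case f d_i = f e_j. *)
Lemma diag_intertwine (f : C -> C) m n (d : 'rV[C]_m) (e : 'rV[C]_n) (T : 'M_(m, n)) :
  diag_mx d *m T = T *m diag_mx e ->
  diag_mx (map_mx f d) *m T = T *m diag_mx (map_mx f e).
Proof.
rewrite !mul_diag_mx !mul_mx_diag => /matrixP dTe; apply/matrixP=> i j.
have := dTe i j; rewrite !mxE [LHS]mulrC.
have [->|T0] := eqVneq (T i j) 0; first by move=> _; rewrite mulr0 mul0r.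
by move=> /(mulfI T0) ->; rewrite mulrC.
Qed.

(** Makes V^* diag(f d) V a function of the matrix V^* diag(d) V, independent of the
    chosen diagonalisation: the functional calculus for normal matrices. *)
Lemma diag_conj_fun (f : C -> C) n (V W : 'M[C]_n) (d e : 'rV[C]_n) :
  V \is unitarymx -> W \is unitarymx ->
  V^t* *m diag_mx d *m V = W^t* *m diag_mx e *m W ->
  V^t* *m diag_mx (map_mx f d) *m V = W^t* *m diag_mx (map_mx f e) *m W.
Proof.
move=> Vu Wu VW; have VV := unitary_mulV Vu; have WW := unitarymxP Wu.
have: diag_mx d *m (V *m W^t*) = (V *m W^t*) *m diag_mx e.
  have := congr1 (fun M => V *m M *m W^t*) VW.
  by rewrite !mulmxA (unitarymxP Vu) mul1mx -!mulmxA WW mulmx1 !mulmxA.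
move=> /(diag_intertwine f) dT.
have := congr1 (fun M => V^t* *m M *m W) dT.
by rewrite !mulmxA VV mul1mx -!mulmxA (unitary_mulV Wu) mulmx1.
Qed.

Lemma diag_conj_sqr n (V : 'M[C]_n) (d : 'rV[C]_n) : V \is unitarymx ->
  (V^t* *m diag_mx d *m V) *m (V^t* *m diag_mx d *m V)
  = V^t* *m diag_mx (map_mx (fun x => x ^+ 2) d) *m V.
Proof.
move=> Vu; rewrite !mulmxA; congr (_ *m V).
rewrite -(mulmxA _ V) (unitarymxP Vu) mulmx1 -mulmxA mulmx_diag.
by congr (_ *m diag_mx _); apply/rowP=> i; rewrite !mxE expr2.
Qed.

(** Uniqueness of the positive square root, for matrices presented as B^* B. *)
Lemma gram_sqr_inj m p n (B : 'M[C]_(m, n)) (D : 'M[C]_(p, n)) :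
  (B^t* *m B) *m (B^t* *m B) = (D^t* *m D) *m (D^t* *m D) ->
  B^t* *m B = D^t* *m D.
Proof.
have [V [d [Vu -> d0]]] := gram_diag B.
have [W [e [Wu -> e0]]] := gram_diag D.
rewrite !diag_conj_sqr // => /(diag_conj_fun sqrtC Vu Wu).
have sq (c : 'rV[C]_n) : (forall i, 0 <= c 0 i) ->
    map_mx sqrtC (map_mx (fun x => x ^+ 2) c) = c.
  by move=> c0; apply/rowP=> i; rewrite !mxE sqrCK.
by rewrite !sq.
Qed.

(** With X^* X = V^* diag(d) V, the rows of b are the d_i^(1/4) v_i for those rows
    v_i of V with d_i != 0. They are orthogonal and nonzero, and the omitted
    rows would not contribute to b^* b. *)
Lemma gram_root m n (X : 'M[C]_(m, n)) r : r = \rank X ->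
  exists b : 'M[C]_(r, n),
    b *m b^t* \in unitmx /\ (b^t* *m b) *m (b^t* *m b) = X^t* *m X.
Proof.
have [V [d [Vu Xd d0]]] := gram_diag X => rX.
pose S := [pred i | d 0 i != 0].
pose q := map_mx (fun x : C => sqrtC (sqrtC x)) d.
have q0 i : 0 <= q 0 i by rewrite mxE !sqrtC_ge0.
have qadj : (diag_mx q)^t* = diag_mx q.
  rewrite tr_diag_mx map_diag_mx; congr diag_mx; apply/rowP=> i; rewrite mxE.
  exact/conj_Creal/ger0_real.
pose B := diag_mx q *m V.
pose b := \matrix_(i < #|S|, j < n) B (enum_val i) j.
have BB : B *m B^t* = diag_mx (map_mx (fun x => x ^+ 2) q).
  rewrite adjmxM mulmxA -(mulmxA _ V) (unitarymxP Vu) mulmx1.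
  rewrite qadj mulmx_diag; congr diag_mx; apply/rowP=> i.
  by rewrite !mxE expr2.
have bb : b^t* *m b = B^t* *m B.
  apply/matrixP=> i j; rewrite [RHS]mxE [RHS](bigID S) /= addrC big1 ?add0r.
    by rewrite (big_enum_val (A := S)) mxE; apply: eq_bigr => l _; rewrite !mxE.
  move=> l /negPn/eqP dl.
  by rewrite /B mul_diag_mx !mxE dl !sqrtC0 !mul0r mulr0.
have bbu : b *m b^t* \in unitmx.
  have -> : b *m b^t* = diag_mx (\row_i (q 0 (enum_val i)) ^+ 2).
    apply/matrixP=> i j; have := congr1 (fun M : 'M_n => M (enum_val i) (enum_val j)) BB.
    rewrite [LHS]mxE => BBij; rewrite [LHS]mxE.
    have -> : \sum_l b i l * (b^t*) l j
            = \sum_l B (enum_val i) l * (B^t*) l (enum_val j).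
      by apply: eq_bigr => l _; rewrite !mxE.
    by rewrite BBij !mxE (inj_eq enum_val_inj).
  rewrite unitmxE det_diag unitfE; apply/prodf_neq0 => i _; rewrite !mxE.
  by rewrite expf_neq0 // !sqrtC_eq0; exact: (enum_valP i).
have b4 : (b^t* *m b) *m (b^t* *m b) = X^t* *m X.
  have -> : b^t* *m b = V^t* *m diag_mx (\row_i (q 0 i * q 0 i)) *m V.
    by rewrite bb /B adjmxM qadj !mulmxA -(mulmxA (V^t*)) mulmx_diag.
  rewrite diag_conj_sqr // Xd; congr (_ *m diag_mx _ *m _); apply/rowP=> i.
  by rewrite !mxE -expr2 !sqrtCK.
have rb : row_free b.
  apply/row_freeP; exists (b^t* *m invmx (b *m b^t*)).
  by rewrite mulmxA mulmxV.
have Er : r = #|S|.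
  rewrite rX -rank_adj_mul -b4 mulmxA mxrankMfree // -mulmxA.
  rewrite mxrankMfree ?row_free_unit //.
  by rewrite mxrank_map mxrank_tr; apply/eqP.
by rewrite Er; exists b.
Qed.

Lemma char_poly_unitary_diag n (V : 'M[C]_n) (d : 'rV[C]_n) : V \is unitarymx ->
  char_poly (V^t* *m diag_mx d *m V) = \prod_(i < n) ('X - (d 0 i)%:P).
Proof.
move=> Vu.
have -> : char_poly (V^t* *m diag_mx d *m V) = char_poly (diag_mx d).
  rewrite /char_poly /char_poly_mx.
  pose P := map_mx polyC V; pose Q := map_mx polyC (V^t*).
  have PQ : Q *m P = 1%:M by rewrite -map_mxM unitary_mulV // map_mx1.
  have -> : 'X%:M - map_mx polyC (V^t* *m diag_mx d *m V)
     = Q *m ('X%:M - map_mx polyC (diag_mx d)) *m P.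
    by rewrite mulmxBr mulmxBl !map_mxM; congr (_ - _);
      rewrite scalar_mxC -mulmxA PQ mulmx1.
  by rewrite -/P !det_mulmx mulrAC -det_mulmx PQ det1 mul1r.
rewrite char_poly_trig ?diag_mx_is_trig //.
by apply: eq_bigr => i _; rewrite mxE eqxx mulr1n.
Qed.

(** * Unitary normal forms of symmetric and skew unitary matrices *)

Lemma diag_unitary n (d : 'rV[C]_n) :
  (forall i, `|d 0 i| = 1) -> diag_mx d \is unitarymx.
Proof.
move=> d1; apply/unitarymxP; rewrite tr_diag_mx map_diag_mx mulmx_diag.
apply/matrixP=> i j; rewrite !mxE.
by rewrite -normCK d1 expr1n.
Qed.

Lemma unitary_diag n (u : 'M[C]_n) : u \is unitarymx ->
  exists (V : 'M[C]_n) (d : 'rV_n), [/\ V \is unitarymx,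
    u = V^t* *m diag_mx d *m V & forall i, `|d 0 i| = 1].
Proof.
move=> uu.
have [V [d [Vu ud]]] : exists (V : 'M[C]_n) (d : 'rV_n), V \is unitarymx /\
    u = V^t* *m diag_mx d *m V.
  by apply: normalmx_diag; rewrite (unitarymxP uu) unitary_mulV.
exists V, d; split=> // i.
have Vi := unitarymxP Vu.
have : diag_mx d \is unitarymx.
  have -> : diag_mx d = V *m u *m V^t*.
    by rewrite ud !mulmxA Vi mul1mx -mulmxA Vi mulmx1.
  by rewrite !mul_unitarymx ?trmxC_unitary.
move=> /unitarymxP/matrixP/(_ i i).
rewrite tr_diag_mx map_diag_mx mulmx_diag !mxE eqxx !mulr1n -normCK => /eqP.
by rewrite sqrp_eq1 // => /eqP.
Qed.

(** Take W = u^(-1/2) by functional calculus. A function of a symmetric matrix is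
    symmetric: transposing V^* diag(d) V gives another diagonalisation of the same
    matrix, with the same d. Hence W u W^T = W u W = 1. *)
Lemma unitary_symmetric_form n (u : 'M[C]_n) : u \is unitarymx -> u^T = u ->
  exists W : 'M[C]_n, W \is unitarymx /\ W *m u *m W^T = 1%:M.
Proof.
move=> uu uT; have [V [d [Vu ud d1]]] := unitary_diag uu.
pose f (x : C) := (sqrtC x)^-1.
pose W := V^t* *m diag_mx (map_mx f d) *m V.
have f1 i : `|f (d 0 i)| = 1.
  rewrite normfV; apply/eqP; rewrite invr_eq1 -sqrp_eq1 //.
  by rewrite -normrX sqrtCK d1.
have WT : W^T = W.
  pose V' := map_mx Num.conj V.
  have V'u : V' \is unitarymx by rewrite conjC_unitary.
  have V'a : V'^t* = V^T by apply/matrixP=> i j; rewrite !mxE conjCK.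
  have tr (e : 'rV[C]_n) : (V^t* *m diag_mx e *m V)^T = V'^t* *m diag_mx e *m V'.
    rewrite !trmx_mul tr_diag_mx mulmxA V'a; congr (_ *m _).
    by apply/matrixP=> i j; rewrite !mxE.
  rewrite tr; apply: esym; apply: diag_conj_fun => //.
  by rewrite -tr -ud uT.
exists W; split.
  rewrite !mul_unitarymx ?trmxC_unitary //.
  by apply: diag_unitary => i; rewrite mxE.
rewrite WT ud /W !mulmxA -[_ *m V *m V^t*]mulmxA (unitarymxP Vu) mulmx1.
rewrite -[_ *m V *m V^t*]mulmxA (unitarymxP Vu) mulmx1.
rewrite -[V^t* *m _ *m _]mulmxA mulmx_diag -[V^t* *m _ *m _]mulmxA mulmx_diag.
set e := \row_j _; have -> : e = const_mx 1.
  apply/rowP=> i; rewrite !mxE mulrAC -expr2 /f exprVn sqrtCK mulVf //.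
  by rewrite -normr_eq0 d1 oner_eq0.
by rewrite diag_const_mx mulmx1 unitary_mulV.
Qed.

(** For eigenrows v_i, v_j of the skew matrix u one has
    d_i v_i v_j^T = v_i u v_j^T = - d_j v_i v_j^T, so the rows selected by P are
    pairwise isotropic for the bilinear dot product, that is, they are
    orthogonal to their complex conjugates. Those conjugates are eigenrows of u
    for - d, and rescaling them by d^-1 completes a symplectic basis. *)
Lemma isotropic_eigenrows n (u : 'M[C]_n) (V : 'M[C]_n) (d : 'rV_n)
    (P : pred 'I_n) :
  u \is unitarymx -> u^T = - u -> V \is unitarymx ->
  u = V^t* *m diag_mx d *m V -> (forall i, `|d 0 i| = 1) ->
  {in P &, forall i j, d 0 i + d 0 j != 0} ->
  exists W : 'M[C]_(#|P| + #|P|, n), W \is unitarymx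
    /\ W *m u *m W^T = block_mx 0 1%:M (- 1%:M) 0.
Proof.
move=> uu uT Vu ud d1 dP.
pose f (i : 'I_#|P|) : 'I_n := enum_val i.
have rows p (A B : 'M[C]_(n, p)) :
    rowsub f A *m (rowsub f B)^T = mxsub f f (A *m B^T).
  by apply/matrixP=> i j; rewrite !mxE; apply: eq_bigr => l _; rewrite !mxE.
pose E := rowsub f V; pose Ec := map_mx Num.conj E.
pose D := diag_mx (\row_i d 0 (f i)); pose Di := diag_mx (\row_i (d 0 (f i))^-1).
have d0 i : d 0 i != 0 by rewrite -normr_eq0 d1 oner_eq0.
have DDi : D *m Di = 1%:M.
  rewrite mulmx_diag -diag_const_mx; congr diag_mx; apply/rowP=> i.
  by rewrite !mxE mulfV.
have Diu : Di \is unitarymx.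
  by apply: diag_unitary => i; rewrite mxE normfV d1 invr1.
have DiT : Di^T = Di by rewrite tr_diag_mx.
have Vud : V *m u = diag_mx d *m V.
  by rewrite ud !mulmxA (unitarymxP Vu) mul1mx.
have Eu : E *m u = D *m E.
  rewrite /E mul_rowsub_mx Vud; apply/matrixP=> i j.
  by rewrite /D !mul_diag_mx !mxE.
have EE : E *m E^t* = 1%:M.
  have -> : E^t* = (rowsub f (map_mx Num.conj V))^T.
    by apply/matrixP=> i j; rewrite !mxE.
  rewrite rows; have -> : V *m (map_mx Num.conj V)^T = 1%:M.
    by rewrite map_trmx (unitarymxP Vu).
  by apply/matrixP=> i j; rewrite !mxE (inj_eq enum_val_inj).
(* Both sides of the relation below are entries of E u E^T, which is skew. *)
have EET : E *m E^T = 0.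
  apply/matrixP=> i j.
  have : (D *m (E *m E^T)) i j = - ((E *m E^T) *m D) i j.
    have -> : (E *m E^T) *m D = (D *m (E *m E^T))^T.
      by rewrite !trmx_mul trmxK tr_diag_mx.
    have -> : D *m (E *m E^T) = E *m u *m E^T by rewrite Eu mulmxA.
    have -> : (E *m u *m E^T)^T = - (E *m u *m E^T).
      by rewrite !trmx_mul trmxK uT mulNmx mulmxN mulmxA.
    by rewrite !mxE opprK.
  rewrite mul_diag_mx mul_mx_diag; set T := E *m E^T; rewrite !mxE => /eqP.
  rewrite mulrC -subr_eq0 opprK -mulrDr mulf_eq0.
  by rewrite (negPf (dP _ _ (enum_valP i) (enum_valP j))) orbF => /eqP.
(* Conjugate E u = D E, using that the conjugate of u is - u^-1. *)
have Ecu : Ec *m u = - (D *m Ec).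
  have uc : map_mx Num.conj u = - u^t*.
    by rewrite uT; apply/matrixP=> i j; rewrite !mxE rmorphN opprK.
  have Dic : map_mx Num.conj D *m D = 1%:M.
    rewrite map_diag_mx mulmx_diag -diag_const_mx; congr diag_mx.
    by apply/rowP=> i; rewrite !mxE mulrC -normCK d1 expr1n.
  have := congr1 (fun M => D *m map_mx Num.conj M *m u) Eu.
  rewrite !map_mxM uc !mulmxN mulNmx -!mulmxA unitary_mulV // mulmx1 mulmxA.
  by rewrite (mulmx1C Dic) mul1mx => ->.
have EcT : Ec^T = E^t* by rewrite map_trmx.
have EcEcT : Ec *m Ec^T = 0.
  by rewrite map_trmx -map_mxM EET map_mx0.
pose F := Di *m Ec.
have Fa : F^t* = E^T *m Di^t*.
  by rewrite adjmxM; congr (_ *m _); apply/matrixP=> i j; rewrite !mxE conjCK.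
have EuF : E *m u *m F^T = 1%:M.
  by rewrite trmx_mul DiT EcT Eu mulmxA -(mulmxA D) EE mulmx1.
exists (col_mx E F); split.
  apply/unitarymxP; rewrite tr_col_mx map_row_mx mul_col_row.
  rewrite EE Fa mulmxA EET mul0mx.
  have -> : F *m E^t* = 0 by rewrite /F -EcT -mulmxA EcEcT mulmx0.
  have -> : F *m (E^T *m Di^t*) = 1%:M.
    rewrite /F mulmxA -(mulmxA Di).
    have -> : Ec *m E^T = 1%:M.
      have := congr1 (map_mx Num.conj) EE; rewrite map_mxM map_mx1 => <-.
      congr (_ *m _); apply/matrixP=> i j; rewrite !mxE.
      exact/esym/conjCK.
    by rewrite mulmx1 (unitarymxP Diu).
  by rewrite -scalar_mx_block.
rewrite mul_col_mx tr_col_mx mul_col_row EuF Eu -mulmxA EET mulmx0.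
have -> : F *m u *m E^T = - 1%:M.
  apply: trmx_inj; rewrite trmx_mul trmxK trmx_mul uT mulNmx mulmxN mulmxA EuF.
  by rewrite linearN /= trmx1.
have -> : F *m u *m F^T = 0.
  rewrite /F -(mulmxA Di Ec) Ecu trmx_mul DiT mulmxN mulNmx !mulmxA.
  by rewrite -(mulmxA _ Ec) EcEcT mulmx0 mul0mx oppr0.
by [].
Qed.

(** Call an eigenvalue d positive when the chosen square root of d^2 is d itself:
    exactly one of d and - d is positive. Neither the positive nor the
    non-positive eigenvalues contain an opposite pair, so each set of
    eigenrows is isotropic and has at most n / 2 elements; since there are n
    eigenrows in all, both sets have exactly n / 2. *)
Lemma unitary_skew_form n (u : 'M[C]_n) : u \is unitarymx -> u^T = - u ->
  exists (m : nat) (W : 'M[C]_(m + m, n)), [/\ n = (m + m)%N, W \is unitarymx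
    & W *m u *m W^T = block_mx 0 1%:M (- 1%:M) 0].
Proof.
move=> uu uT; have [V [d [Vu ud d1]]] := unitary_diag uu.
pose P : pred 'I_n := [pred i | sqrtC (d 0 i ^+ 2) == d 0 i].
have dn0 i : d 0 i + d 0 i != 0.
  by rewrite -mulr2n mulrn_eq0 /= -normr_eq0 d1 oner_eq0.
have sq_opp i j : d 0 i + d 0 j = 0 -> d 0 i ^+ 2 = d 0 j ^+ 2.
  by move=> /eqP; rewrite addr_eq0 => /eqP ->; rewrite sqrrN.
have posP : {in P &, forall i j, d 0 i + d 0 j != 0}.
  move=> i j /eqP Pi /eqP Pj; apply/negP => /eqP dij.
  have dE : d 0 i = d 0 j by rewrite -Pi (sq_opp _ _ dij) Pj.
  by move: (dn0 i); rewrite {2}dE dij eqxx.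
have sqr_pm (x : C) : sqrtC (x ^+ 2) != x -> sqrtC (x ^+ 2) = - x.
  by have /eqP := sqrtCK (x ^+ 2); rewrite eqf_sqr => /orP[->|/eqP].
have negP : {in predC P &, forall i j, d 0 i + d 0 j != 0}.
  move=> i j /sqr_pm Pi /sqr_pm Pj; apply/negP => /eqP dij.
  have dE : d 0 i = d 0 j by apply: oppr_inj; rewrite -Pi (sq_opp _ _ dij) Pj.
  by move: (dn0 i); rewrite {2}dE dij eqxx.
have [W [Wu WS]] := isotropic_eigenrows uu uT Vu ud d1 posP.
have [W' [W'u _]] := isotropic_eigenrows uu uT Vu ud d1 negP.
exists #|P|, W; split=> //.
have le1 : (#|P| + #|P| <= n)%N by rewrite -(mxrank_unitary Wu) rank_leq_col.
have le2 : (#|predC P| + #|predC P| <= n)%N.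
  by rewrite -(mxrank_unitary W'u) rank_leq_col.
have card : (#|P| + #|predC P|)%N = n by rewrite cardC card_ord.
apply/eqP; rewrite eqn_leq le1 andbT -{1}card leq_add2l.
by rewrite -(leq_add2r #|predC P|) card.
Qed.

(** * Balanced factorisations *)

(** A point of the quiver over X for a nilpotent of step two: the second equation
    is the real moment map equation, and invertibility of b b^* = a^* a
    expresses that b is onto and a is injective. *)
Definition balanced_factorization n r (X : 'M[C]_n) (a : 'M[C]_(n, r))
    (b : 'M[C]_(r, n)) : Prop :=
  [/\ X = a *m b, b *m b^t* = a^t* *m a & b *m b^t* \in unitmx].

Lemma balanced_gram n r (X : 'M[C]_n) (a : 'M[C]_(n, r)) (b : 'M[C]_(r, n)) :
  X = a *m b -> b *m b^t* = a^t* *m a ->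
  X^t* *m X = (b^t* *m b) *m (b^t* *m b).
Proof.
by move=> -> ba; rewrite adjmxM mulmxA -(mulmxA _ (a^t*)) -ba !mulmxA.
Qed.

(** Given the square root b^* b of X^* X, the condition X = a b forces
    a = X b^* (b b^* )^-1. *)
Lemma balanced_factorization_exists n r (X : 'M[C]_n) : r = \rank X ->
  exists (a : 'M[C]_(n, r)) (b : 'M[C]_(r, n)), balanced_factorization X a b.
Proof.
move=> /gram_root[b [Gu bX]]; pose G := b *m b^t*.
have GVa : (invmx G)^t* = invmx G by rewrite adjmxV adjmxM trmxCK.
exists (X *m b^t* *m invmx G), b; split=> //.
  (* Z projects onto the kernel of b, on which X must vanish. *)
  pose Z := 1%:M - b^t* *m invmx G *m b.
  have bZ : b *m Z = 0.
    by rewrite mulmxBr mulmx1 !mulmxA -/G mulmxV // mul1mx subrr.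
  have XZ : (X *m Z)^t* *m (X *m Z) = 0.
    by rewrite adjmxM -mulmxA (mulmxA _ X) -bX -!mulmxA bZ !mulmx0.
  have /eqP : \rank (X *m Z) = 0%N by rewrite -rank_adj_mul XZ mxrank0.
  rewrite mxrank_eq0 mulmxBr mulmx1 subr_eq0 => /eqP {1}->.
  by rewrite !mulmxA.
rewrite !adjmxM trmxCK GVa -!mulmxA (mulmxA _ X) -bX -!mulmxA -/G.
rewrite (mulmxA b (b^t*)) (mulmxA b (b^t*)) (mulmxA b (b^t*)) -/G.
by rewrite mulmxV // mulmx1 mulmxA mulVmx // mul1mx.
Qed.

(** Both b^* b and b'^* b' are the positive square root of X^* X, so the
    columns of b and b' have the same Gram matrix, and a unitary u maps the
    former to the latter. *)
Lemma balanced_factorization_unique n r (X : 'M[C]_n) (a a' : 'M[C]_(n, r))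
    (b b' : 'M[C]_(r, n)) :
  balanced_factorization X a b -> balanced_factorization X a' b' ->
  exists u : 'M[C]_r, [/\ u \is unitarymx, b' = u *m b & a = a' *m u].
Proof.
move=> [Xab ba Gu] [Xab' ba' Gu']; pose G := b *m b^t*.
have bb : b^t* *m b = b'^t* *m b'.
  by apply: gram_sqr_inj; rewrite -(balanced_gram Xab ba) (balanced_gram Xab' ba').
pose u := b' *m b^t* *m invmx G.
have GVa : (invmx G)^t* = invmx G by rewrite adjmxV adjmxM trmxCK.
have b'E : b' = u *m b.
  (* b and b' have the same kernel, the image of the projection Z. *)
  pose Z := 1%:M - b^t* *m invmx G *m b.
  have bZ : b *m Z = 0.
    by rewrite mulmxBr mulmx1 !mulmxA -/G mulmxV // mul1mx subrr.
  have : invmx (b' *m b'^t*) *m (b' *m (b'^t* *m b') *m Z) = 0.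
    by rewrite -bb -!mulmxA bZ !mulmx0.
  rewrite -!mulmxA (mulmxA b') mulKmx // mulmxBr mulmx1 => /eqP.
  by rewrite subr_eq0 => /eqP {1}->; rewrite !mulmxA.
exists u; split=> //.
  rewrite -trmxC_unitary; apply/unitarymxP; rewrite trmxCK.
  rewrite /u !adjmxM GVa trmxCK -!mulmxA (mulmxA _ b') -bb -!mulmxA -/G.
  by rewrite 2!(mulmxA b (b^t*)) -/G mulmxV // mulmx1 mulVmx.
have aG : a *m G = a' *m u *m G.
  by rewrite /G mulmxA -Xab Xab' {1}b'E !mulmxA.
by rewrite -[LHS](mulmxK Gu) -/G aG mulmxK.
Qed.

(** X is the opposite of its adjoint for Om, which exchanges the two factors; the
    unitarity of Om keeps the factorisation balanced. *)
Lemma balanced_factorization_transpose n r (Om X : 'M[C]_n)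
    (a : 'M[C]_(n, r)) (b : 'M[C]_(r, n)) :
  Om \is unitarymx -> X^T *m Om + Om *m X = 0 ->
  balanced_factorization X a b ->
  balanced_factorization X (- (invmx Om *m b^T)) (a^T *m Om).
Proof.
move=> Omu XOm [Xab ba Gu]; have Omi := unitarymx_unit Omu.
have conjG : a^T *m Om *m (a^T *m Om)^t* = map_mx Num.conj (b *m b^t*).
  rewrite adjmxM mulmxA mulmxtVK // ba map_mxM /=.
  by congr (_ *m _); apply/matrixP=> i j; rewrite !mxE ?conjCK.
split.
- have : Om *m X = - (X^T *m Om) by apply/eqP; rewrite -addr_eq0 addrC XOm.
  move=> /(congr1 (mulmx (invmx Om))); rewrite mulKmx // => ->.
  by rewrite Xab trmx_mul mulNmx mulmxN !mulmxA.
- rewrite conjG adjmxN mulNmx mulmxN opprK adjmxM adjmxV.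
  rewrite -(invmx_unitary Omu) invmxK -mulmxA (mulmxA Om) mulmxV // mul1mx.
  rewrite map_mxM trmxK; congr (_ *m _).
  by apply/matrixP=> i j; rewrite !mxE; exact/conjCK.
- by rewrite conjG map_unitmx.
Qed.

End HermitianMatrices.

(** * The trace of the square root *)

Section ClassicalOrbits.
Variable R : realType.
Local Notation C := R[i].

(** If the eigenvalues of B^* B are d_i >= 0, those of its square are d_i^2; the
    sum over distinct eigenvalues with multiplicities is the sum of the d_i. *)
Lemma sum_sqrt_spectrum m n (B : 'M[C]_(m, n)) :
  \sum_(mu \in spectrum ((B^t* *m B) *m (B^t* *m B)))
     (multiplicity ((B^t* *m B) *m (B^t* *m B)) mu)%:R * sqrtC mu
  = \tr (B^t* *m B).
Proof.
have [V [d [Vu -> d0]]] := gram_diag B.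
rewrite diag_conj_sqr // /spectrum /multiplicity.
set M := V^t* *m _ *m V.
pose s := [seq d 0 i ^+ 2 | i <- enum 'I_n].
have cM : char_poly M = \prod_(x <- s) ('X - x%:P).
  rewrite char_poly_unitary_diag // big_map big_enum.
  by apply: eq_bigr => i _; rewrite mxE.
have -> : [set mu | eigenvalue M mu] = [set` undup s].
  by apply/seteqP; split=> mu /=;
    rewrite eigenvalue_root_char cM root_prod_XsubC mem_undup.
rewrite -fsbig_seq ?undup_uniq //.
under eq_bigr do rewrite cM mu_prod_XsubC mulr_natl.
have := big_undup_iterop_count +%R s predT (fun x : C => sqrtC x).
rewrite [LHS](eq_bigr (fun x => sqrtC x *+ count_mem x s)) => [->|x _]; last first.
  by [].
rewrite big_map big_enum -mulmxA mxtrace_mulC -mulmxA (unitarymxP Vu) mulmx1.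
rewrite mxtrace_diag.
by apply: eq_bigr => i _; rewrite sqrCK.
Qed.

(** * Forms compatible with the Hermitian product *)

Lemma unitary_congrK n (U Om S : 'M[C]_n) : U \is unitarymx ->
  U *m Om *m U^T = S -> Om = U^t* *m S *m (U^t*)^T.
Proof.
move=> Uu <-; rewrite !mulmxA unitary_mulV // mul1mx -mulmxA -trmx_mul.
by rewrite unitary_mulV // trmx1 mulmx1.
Qed.

Lemma symplectic_unitary m :
  block_mx 0 1%:M (- 1%:M) 0 \is @unitarymx C (m + m) (m + m).
Proof.
apply/unitarymxP; rewrite tr_block_mx map_block_mx adjmxN adjmx1 !trmx0 !map_mx0.
rewrite mulmx_block !(mul0mx, mulmx0, mulNmx, mulmxN, mulmx1) !(addr0, add0r).
by rewrite opprK -scalar_mx_block.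
Qed.

Lemma symplectic_tr m :
  (block_mx 0 1%:M (- 1%:M) 0 : 'M[C]_(m + m))^T
  = - block_mx 0 1%:M (- 1%:M) 0.
Proof.
rewrite tr_block_mx opp_block_mx !trmx0 trmx1 oppr0 opprK.
by congr block_mx; apply/matrixP=> i j; rewrite !mxE eq_sym.
Qed.

Lemma compatible_form_standard sk n (Om : 'M[C]_n) : compatible_form sk Om ->
  exists U S : 'M[C]_n, [/\ U \is unitarymx, S \is unitarymx,
    S^T = (-1) ^+ sk *: S & Om = U *m S *m U^T].
Proof.
case: sk => [[m [U [En Uu UO]]]|[U [Uu UO]]].
  subst n; exists (U^t*), (block_mx 0 1%:M (- 1%:M) 0); split.
  - by rewrite trmxC_unitary.
  - exact: symplectic_unitary.
  - by rewrite symplectic_tr scaleN1r.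
  - exact: unitary_congrK.
exists (U^t*), 1%:M; split.
- by rewrite trmxC_unitary.
- by apply/unitarymxP; rewrite adjmx1 mulmx1.
- by rewrite trmx1 scale1r.
- exact: unitary_congrK.
Qed.

Lemma compatible_form_unitary sk n (Om : 'M[C]_n) :
  compatible_form sk Om -> Om \is unitarymx.
Proof.
move=> /compatible_form_standard[U [S [Uu Su _ ->]]].
by rewrite !mul_unitarymx ?trmx_unitary.
Qed.

Lemma compatible_form_tr sk n (Om : 'M[C]_n) :
  compatible_form sk Om -> Om^T = (-1) ^+ sk *: Om.
Proof.
move=> /compatible_form_standard[U [S [_ _ ST ->]]].
by rewrite !trmx_mul trmxK ST -scalemxAl -scalemxAr mulmxA.
Qed.

Lemma unitary_compatible_form (sk : bool) n (u : 'M[C]_n) : u \is unitarymx ->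
  u^T = (-1) ^+ sk *: u -> compatible_form sk u.
Proof.
move=> uu; case: sk.
  by rewrite expr1 scaleN1r => /(unitary_skew_form uu).
by rewrite expr0 scale1r => /(unitary_symmetric_form uu).
Qed.

Lemma compatible_form_congr sk n (Om u : 'M[C]_n) :
  compatible_form sk Om -> compatible_form sk u ->
  exists v : 'M[C]_n, v \is unitarymx /\ u = v^T *m Om *m v.
Proof.
have main m (U W : 'M[C]_(m, n)) S : n = m -> U \is unitarymx ->
    W \is unitarymx -> U *m Om *m U^T = S -> W *m u *m W^T = S ->
    exists v : 'M[C]_n, v \is unitarymx /\ u = v^T *m Om *m v.
  move=> En; subst m => Uu Wu <- Wuu.
  exists (U^T *m (W^t*)^T); split.
    by rewrite mul_unitarymx ?trmx_unitary ?trmxC_unitary.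
  rewrite (unitary_congrK Wu Wuu).
  by rewrite trmx_mul !trmxK !mulmxA.
case: sk => [[m [U [En Uu UO]]] [m' [W [En' Wu Wuu]]]|[U [Uu UO]] [W [Wu Wuu]]].
  have Em : m' = m by apply: double_inj; rewrite -!addnn -En -En'.
  by subst m'; exact: main En Uu Wu UO Wuu.
exact: main erefl Uu Wu UO Wuu.
Qed.

(** Comparing a balanced factorisation with its transpose produces a unitary u
    with a^T Om = u b. It has the symmetry opposite to that of Om, so it is
    v^T Os v for a unitary v, and (a v^-1, v b) is the required pair. *)
Lemma adjoint_factorization_exists sk n r (Om X : 'M[C]_n) (Os : 'M[C]_r) :
  compatible_form sk Om -> compatible_form (~~ sk) Os ->
  X^T *m Om + Om *m X = 0 -> r = \rank X ->
  exists (a : 'M[C]_(n, r)) (b : 'M[C]_(r, n)),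
    balanced_factorization X a b /\ b = form_adjoint Om Os a.
Proof.
move=> cOm cOs XOm /balanced_factorization_exists[a [b Xab]].
have Omu := compatible_form_unitary cOm; have Omi := unitarymx_unit Omu.
have := balanced_factorization_transpose Omu XOm Xab.
move=> /(balanced_factorization_unique Xab)[u [uu bE aE]].
have [Xab1 ba Gu] := Xab.
have uT : u^T = (-1) ^+ (~~ sk) *: u.
  have aTO : b^T *m u^T = (-1) ^+ sk *: (Om *m a).
    have := congr1 trmx bE; rewrite !trmx_mul trmxK (compatible_form_tr cOm).
    by rewrite -scalemxAl => ->.
  have bTu : b^T *m u = - (Om *m a).
    by rewrite aE mulNmx mulmxN opprK mulmxA mulmxA mulmxV // mul1mx.
  have : b^T *m u^T = b^T *m ((-1) ^+ (~~ sk) *: u).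
    rewrite aTO -scalemxAr bTu; case: (sk); rewrite !(expr0, expr1).
      by rewrite scaleN1r scale1r.
    by rewrite scaleN1r scale1r opprK.
  (* b^T can be cancelled because the rows of b are independent. *)
  move=> /(congr1 (mulmx ((invmx (b *m b^t*))^T *m (b^t*)^T))).
  have K : (invmx (b *m b^t*))^T *m (b^t*)^T *m b^T = 1%:M.
    by rewrite -mulmxA -!trmx_mul mulmxV // trmx1.
  by rewrite !mulmxA K !mul1mx.
have [v [vu uE]] := compatible_form_congr cOs (unitary_compatible_form uu uT).
have vi := unitarymx_unit vu; have Osi := unitarymx_unit (compatible_form_unitary cOs).
exists (a *m invmx v), (v *m b); split; last first.
  rewrite /form_adjoint trmx_mul -!mulmxA bE uE trmx_inv -!mulmxA mulKmx ?unitmx_tr //.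
  by rewrite mulKmx.
have vG : v *m b *m (v *m b)^t* = v *m (b *m b^t*) *m v^t*.
  by rewrite adjmxM !mulmxA.
split.
- by rewrite -mulmxA mulKmx.
- by rewrite vG ba adjmxM (invmx_unitary vu) trmxCK !mulmxA.
- by rewrite vG !unitmx_mul vi Gu unitarymx_unit ?trmxC_unitary.
Qed.

(** * Adjoint orbits *)

Lemma conj_in_form_lie n (Om P A : 'M[C]_n) : P \in unitmx ->
  P^T *m Om *m P = Om -> A^T *m Om + Om *m A = 0 ->
  (P *m A *m invmx P)^T *m Om + Om *m (P *m A *m invmx P) = 0.
Proof.
move=> Pu POm AOm; have PTu : P^T \in unitmx by rewrite unitmx_tr.
have OmP : Om *m P = invmx P^T *m Om by rewrite -[in RHS]POm -mulmxA mulKmx.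
have POm' : P^T *m Om = Om *m invmx P by rewrite -[in RHS]POm mulmxK.
rewrite !trmx_mul trmx_inv !mulmxA OmP -(mulmxA _ P^T) POm'.
by rewrite !mulmxA -mulmxDl -(mulmxA _ (A^T)) -(mulmxA _ Om) -mulmxDr AOm mulmx0 mul0mx.
Qed.

Lemma in_group_unit n (g : classical_lie R n) (P : 'M[C]_n) :
  classical_lie_ok g -> in_group g P -> P \in unitmx.
Proof.
have unitP sk (Om : 'M[C]_n) : compatible_form sk Om ->
    P^T *m Om *m P = Om -> P \in unitmx.
  move=> /compatible_form_unitary/unitarymx_unit Omu POm.
  by move: Omu; rewrite -POm unitmx_mul => /andP[].
case: g => [|Om|Om] /=.
- by move=> _ dP; rewrite unitmxE dP unitr1.
- by move=> cOm [POm _]; exact: (unitP false Om).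
- by move=> cOm POm; exact: (unitP true Om).
Qed.

Lemma adjoint_orbit_rank n (g : classical_lie R n) (A X : 'M[C]_n) :
  classical_lie_ok g -> adjoint_orbit g A X -> \rank X = \rank A.
Proof.
move=> gok [P [/(in_group_unit gok) Pu ->]].
rewrite mxrankMfree ?row_free_unit ?unitmx_inv //.
have Pf : row_full P by rewrite row_full_unit.
by have -> := eqmxMfull A Pf.
Qed.

Lemma adjoint_orbit_in_lie n (g : classical_lie R n) (A X : 'M[C]_n) :
  classical_lie_ok g -> in_lie g A -> adjoint_orbit g A X -> in_lie g X.
Proof.
move=> gok gA [P [gP ->]]; have Pu := in_group_unit gok gP.
case: g gok gA gP => [|Om|Om] /= gok gA gP.
- by rewrite mxtrace_mulC mulmxA mulVmx // mul1mx.
- by apply: conj_in_form_lie => //; case: gP.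
- exact: conj_in_form_lie.
Qed.

Lemma adjoint_orbit_refl n (g : classical_lie R n) (A : 'M[C]_n) :
  adjoint_orbit g A A.
Proof.
exists 1%:M; split; last by rewrite invmx1 mul1mx mulmx1.
by case: g => [|Om|Om] /=; rewrite ?trmx1 ?mul1mx ?mulmx1 ?det1.
Qed.

(** * Quiver points over a nilpotent of step two *)

Lemma mulmx_dim0 m n p (A : 'M[C]_(m, n)) (B : 'M[C]_(n, p)) : n = 0%N -> A *m B = 0.
Proof. by move=> n0; subst n; rewrite thinmx0 mul0mx. Qed.

(** When A squares to zero all the spaces of the chain after the second one are
    zero, so that zero is the only choice for the remaining maps. *)
Definition two_step_point N (A : 'M[C]_N) (a : 'M[C]_(N, chain_dim A 1))
    (b : 'M[C]_(chain_dim A 1, N)) : quiver_point A :=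
  @QuiverPoint R N A
    (fun j => match j return 'M[C]_(chain_dim A j, chain_dim A j.+1) with
              | 0%N => a | _ => 0 end)
    (fun j => match j return 'M[C]_(chain_dim A j.+1, chain_dim A j) with
              | 0%N => b | _ => 0 end).

(** The complex moment map equation b a = 0 comes for free: a (b a) b = X^2 = 0,
    with a injective and b onto. *)
Lemma balanced_quiver_point N (A X : 'M[C]_N) a b : A ^+ 2 = 0 -> X ^+ 2 = 0 ->
  balanced_factorization X a b ->
  [/\ moment_zero 2 (@two_step_point N A a b), quiver_regular 2 (two_step_point a b)
    & quiver_psi (two_step_point a b) = X].
Proof.
move=> A2 X2 [Xab ba Gu].
have dim2 : chain_dim A 2 = 0%N by rewrite /= A2 mxrank0.
split; last by rewrite /quiver_psi /= -Xab.
  case=> // _; split.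
    rewrite mulmx_dim0 //=.
    (* (b b^* )^-1 a^* is a left inverse of a and b^* (b b^* )^-1 a right inverse
       of b; they extract b a from X X = a (b a) b. *)
    have : invmx (b *m b^t*) *m (a^t* *m (X *m X) *m b^t*) *m invmx (b *m b^t*) = 0.
      by rewrite [X *m X]X2 mulmx0 mul0mx mulmx0 mul0mx.
    rewrite Xab !mulmxA -(mulmxA _ (a^t*) a) -ba mulVmx // mul1mx.
    by rewrite -(mulmxA _ b (b^t*)) mulmxK // => ->.
  by rewrite !(mulmx_dim0 _ _ dim2) /= subrr add0r ba subrr.
case=> [|[|//]] _; rewrite /=.
  split=> [x y /= axy|y].
    have : a^t* *m (a *m x) = a^t* *m (a *m y) by rewrite axy.
    by rewrite !mulmxA -ba => /(congr1 (mulmx (invmx (b *m b^t*)))); rewrite !mulKmx.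
  by exists (b^t* *m (invmx (b *m b^t*) *m y)); rewrite mulmxA mulKVmx.
have all0 (m : nat) (x y : 'cV[C]_m) : m = 0%N -> x = y.
  by move=> m0; subst m; rewrite (flatmx0 x) (flatmx0 y).
by split=> [x y _|y]; [exact: all0|exists 0; exact: all0].
Qed.

Lemma quiver_norm2_two_step N (A X : 'M[C]_N) (p : quiver_point A) :
  A ^+ 2 = 0 -> moment_zero 2 p -> quiver_psi p = X ->
  quiver_norm2 2 p = 2 * \sum_(mu \in spectrum (X^t* *m X))
                           (multiplicity (X^t* *m X) mu)%:R * sqrtC mu.
Proof.
move=> A2 /(_ 0%N isT)[_ m0] psiX.
have dim2 : chain_dim A 2 = 0%N by rewrite /= A2 mxrank0.
have ba : qbeta p 0 *m (qbeta p 0)^t* = (qalpha p 0)^t* *m qalpha p 0.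
  apply/eqP; rewrite -subr_eq0; apply/eqP; rewrite -[RHS]m0.
  by rewrite !(mulmx_dim0 _ _ dim2) subrr add0r.
rewrite (balanced_gram (esym psiX) ba) sum_sqrt_spectrum.
by rewrite /quiver_norm2 big_ord1 /= -ba mxtraceD -mulr2n mxtrace_mulC mulr_natl.
Qed.

End ClassicalOrbits.

Theorem theorem3p1 (R : realType) (N : nat) (g : classical_lie R N)
    (hg : classical_lie_ok g)
    (A : 'M[R[i]]_N) (hA : in_lie g A) (hA0 : A != 0)
    (k : nat) (hk : A ^+ k = 0) (hk' : A ^+ k.-1 != 0)
    (hsq : forall X, adjoint_orbit g A X -> X ^+ 2 = 0)
    (om : forall j, 'M[R[i]]_(chain_dim A j)) (hom : chain_forms_ok g k om)
    (rho : 'M[R[i]]_N -> R) :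
  hyperKahler_potential g k om rho <->
  (forall X, adjoint_orbit g A X ->
     (rho X)%:C =
       2 * \sum_(mu \in spectrum (X^t* *m X))
             (multiplicity (X^t* *m X) mu)%:R * sqrtC mu).
Proof.
have A2 : A ^+ 2 = 0 := hsq A (adjoint_orbit_refl g A).
have k2 : k = 2%N.
  case: k hk hk' {hom} => [|[|[|k]]] //=.
  - by move=> A0 /negP[]; apply/eqP.
  - by rewrite expr1 => A0; case/eqP: hA0.
  - by move=> _; rewrite -addn2 exprD A2 mulr0 eqxx.
subst k; split=> [rhoP X XA|rhoE X XA p _ p0 _ pX]; last first.
  by rewrite (quiver_norm2_two_step A2 p0 pX) rhoE.
have rX : chain_dim A 1 = \rank X by rewrite (adjoint_orbit_rank hg XA).
have gX := adjoint_orbit_in_lie hg hA XA.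
have [a [b [Xab bW]]] : exists a b, balanced_factorization X a b
    /\ in_Wspace g 2 om (two_step_point a b).
  have form_case sk Om : om 0%N = Om ->
      (forall j, (j <= 2)%N -> compatible_form (sk (+) odd j) (om j)) ->
      X^T *m Om + Om *m X = 0 -> exists a b, balanced_factorization X a b
        /\ b = form_adjoint (om 0%N) (om 1%N) a.
    move=> <- omP XOm; apply: (adjoint_factorization_exists (sk := sk)) XOm rX.
      by have := omP 0%N isT; rewrite addbF.
    by have := omP 1%N isT; rewrite addbT.
  case: g hg hA hsq hom XA gX {rhoP} => [|Om|Om] /=.
  - by have [a [b Xab]] := balanced_factorization_exists rX; exists a, b; split.
  - move=> _ _ _ [om0 omP] _ XOm.
    have [a [b [Xab bE]]] := form_case false Om om0 omP XOm.
    by exists a, b; split=> // -[].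
  - move=> _ _ _ [om0 omP] _ XOm.
    have [a [b [Xab bE]]] := form_case true Om om0 omP XOm.
    by exists a, b; split=> // -[].
have [p0 preg pX] := balanced_quiver_point A2 (hsq X XA) Xab.
by rewrite (rhoP X XA _ bW p0 preg pX) (quiver_norm2_two_step A2 p0 pX).
Qed.
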